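(* For every infinite countable amenable group $G$ and every $\varepsilon>0$, there exists a subshift $X\subseteq\{0,1\}^G$ such that $X$ is strongly aperiodic and $\alpha(X)\ge2-\varepsilon$ (or equivalently, when $\varepsilon<2$, $h(X)\ge\log(2-\varepsilon)$).
   Context: Let $\mathcal{A}=\{0,1\}$. A pattern over $G$ is an element $p\in\mathcal{A}^S$ with $S=\operatorname{supp}(p)\subseteq G$ non-empty and finite. A pattern $f$ appears in a configuration $x\in\mathcal{A}^G$ if there is $g\in G$ with $x(gs)=f(s)$ for all $s\in\operatorname{supp}(f)$; otherwise $x$ avoids $f$. A subshift is a set of the form $X=\{x\in\mathcal{A}^G:x\text{ avoids every }f\in\mathcal{F}\}$ for some set of patterns $\mathcal{F}$. For finite $S\subseteq G$ let $\mathcal{G}^{(S)}$ be the set of $p\in\mathcal{A}^S$ that appear in some $x\in X$. The growth of $X$ is $\alpha(X)=\lim_{n\to\infty}\big(\min_{S\subseteq G,|S|=n}|\mathcal{G}^{(S)}|\big)^{1/n}$ (the limit exists). The topological entropy is $h(X)=\lim_{n\to\infty}\frac{\log|\mathcal{G}^{(S_n)}|}{|S_n|}$ where $(S_n)$ is a symmetric Følner sequence of $G$: finite sets with $S_n=S_n^{-1}$ and $|(g\cdot S_n)\Delta S_n|/|S_n|\to0$ for every $g\in G$. A configuration $x$ has period $g\in G$ if $x(y)=x(gy)$ for all $y\in G$; it is strongly aperiodic if its only period is $1_G$; a subshift is strongly aperiodic if all its configurations are. *)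

(* Defs.v *)
From HB Require Import structures.
From mathcomp Require Import all_boot all_order all_algebra finmap.
From mathcomp Require Import all_classical all_reals all_analysis.

Set Implicit Arguments.
Unset Strict Implicit.
Unset Printing Implicit Defensive.

Import Order.TTheory GRing.Theory Num.Theory.
Import numFieldNormedType.Exports.

Local Open Scope classical_set_scope.
Local Open Scope fset_scope.
Local Open Scope ring_scope.

(* The alphabet {0,1} is bool; a groupType may be infinite. *)

Definition config (G : groupType) := G -> bool.

Definition appears (G : groupType) (S : {fset G}) (p : {ffun S -> bool})
    (x : config G) : Prop :=
  exists g : G, forall s : S, x (g * val s)%g = p s.

Record pattern (G : groupType) := Pattern {
  supp : {fset G};
  supp_neq0 : supp != fset0;
  pat :> {ffun supp -> bool} }.

Definition avoids (G : groupType) (x : config G) (f : pattern G) : Prop :=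
  ~ appears f x.

Definition is_subshift (G : groupType) (X : set (config G)) : Prop :=
  exists F : set (pattern G), X = [set x | forall f, F f -> avoids x f].

(* S may be empty here, hence the raw finite functions rather than [pattern]. *)
Definition language (G : groupType) (X : set (config G)) (S : {fset G}) :
    {set {ffun S -> bool}} :=
  [set p : {ffun S -> bool} | `[< exists2 x, X x & appears p x >]]%SET.

(* When G is infinite, the set below is a nonempty set of natural numbers, so
   that its infimum is its minimum. *)
Definition min_complexity (R : realType) (G : groupType) (X : set (config G))
    (n : nat) : R :=
  inf [set #|language X S|%:R | S in [set S : {fset G} | #|` S| = n]].

Definition growth_seq (R : realType) (G : groupType) (X : set (config G))
    (n : nat) : R :=
  min_complexity R X n `^ n%:R^-1.

Definition growth (R : realType) (G : groupType) (X : set (config G)) : R :=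
  limn (growth_seq R X).

(* Nonemptiness is needed because x / 0 = 0: otherwise S_n = fset0 would
   qualify in every group. *)
Definition folner (R : realType) (G : groupType) (S : nat -> {fset G}) : Prop :=
  (forall n, S n != fset0) /\
  forall g : G,
    (fun n => let gS := [fset (g * s)%g | s in S n] in
       #|` (gS `\` S n) `|` (S n `\` gS)|%:R / #|` S n|%:R : R) @ \oo --> (0 : R).

Definition symmetric_folner (R : realType) (G : groupType)
    (S : nat -> {fset G}) : Prop :=
  folner R S /\ forall n, [fset (s^-1)%g | s in S n] = S n.

(* For countable groups: existence of a (not necessarily symmetric) Folner
   sequence. *)
Definition amenable (R : realType) (G : groupType) : Prop :=
  exists S : nat -> {fset G}, folner R S.

(* Extended reals, because the empty subshift has entropy log 0 = -oo. *)
Definition entropy_seq (R : realType) (G : groupType) (X : set (config G))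
    (S : nat -> {fset G}) (n : nat) : \bar R :=
  (lne (#|language X (S n)|%:R)%:E * (#|` S n|%:R^-1)%:E)%E.

Definition entropy (R : realType) (G : groupType) (X : set (config G))
    (S : nat -> {fset G}) : \bar R :=
  limn (entropy_seq R X S).

Definition has_period (G : groupType) (x : config G) (g : G) : Prop :=
  forall y : G, x y = x (g * y)%g.

Definition strongly_aperiodic_config (G : groupType) (x : config G) : Prop :=
  forall g : G, has_period x g -> g = 1%g.

Definition strongly_aperiodic (G : groupType) (X : set (config G)) : Prop :=
  forall x, X x -> strongly_aperiodic_config x.

(* Main.v *)
(* The subshift consists of the x such that, for all g <> 1 and k, the patterns
   of x on k T_g and on k g T_g differ, where T_g is a finite set disjoint from
   g T_g. A period g of x would make them equal for k = 1, so that X is strongly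
   aperiodic. By Rosenfeld's counting argument, if the sizes of the T_g grow fast
   enough along an enumeration of G, then adding a point to a finite set
   multiplies the number of its locally admissible patterns by at least
   b = max(2 - eps, 3/2); compactness turns this into |L(S)| >= b^|S| for all
   finite S.
   Both limits are governed by m = inf_T log|L(T)| / |T| over finite nonempty T.
   The growth is exp m because disjoint translates of a near-optimal T have
   language at most the product of the languages. The entropy is m because
   Shearer's inequality, for the cover of S_n by the translates of T that meet
   it, bounds log|L(S_n)| / |S_n| by log|L(T)| / |T|, up to the translates that
   meet both S_n and its complement: these are o(|S_n|). *)

Require Import Defs.
From HB Require Import structures.
From mathcomp Require Import all_boot all_order all_algebra finmap.
From mathcomp Require Import all_classical all_reals all_analysis.
From mathcomp Require Import zify ring lra.

Set Implicit Arguments.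
Unset Strict Implicit.
Unset Printing Implicit Defensive.

Import Order.TTheory GRing.Theory Num.Theory.
Import numFieldNormedType.Exports.

Local Open Scope classical_set_scope.
Local Open Scope ring_scope.

(** * Shearer's inequality for families of finite sets *)

Section Shearer.
Local Open Scope fset_scope.
Local Open Scope ring_scope.
Variable R : realType.

(** AM-GM gives the exponent [#|J|]; as the mean is at most 1, lowering the exponent to [k] can only
    increase the power. *)
Lemma prod_le_mean (I : finType) (J : {pred I}) (k : nat) (p : I -> R) :
  (0 < k <= #|J|)%N -> {in J, forall i, 0 <= p i <= 1} ->
  \prod_(i in J) p i <= ((\sum_(i in J) p i) / #|J|%:R) ^+ k.
Proof.
move=> /andP[k0 kJ] p01.
have J0 : (0 < #|J|)%N by exact: leq_trans k0 kJ.
have mu0 : 0 <= (\sum_(i in J) p i) / #|J|%:R.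
  by apply: divr_ge0 => //; apply: sumr_ge0 => i /p01/andP[].
have mu1 : (\sum_(i in J) p i) / #|J|%:R <= 1.
  rewrite ler_pdivrMr ?ltr0n// mul1r -sumr_const.
  by apply: ler_sum => i /p01/andP[].
have [|pm _] := @leif_AGM R I J p; first by move=> i /p01/andP[].
exact: (le_trans pm (ler_wiXn2l mu0 mu1 kJ)).
Qed.

(* Dividing both products by prod (a + b) reduces the claim to AM-GM applied to
   the probabilities a / (a + b) and b / (a + b), whose means add up to 1. *)
Lemma expD_le_prodD (I : finType) (J : {pred I}) (k : nat) (c x y : R)
    (a b : I -> R) :
  (0 < k <= #|J|)%N -> 0 <= c -> 0 <= x -> 0 <= y ->
  (forall i, 0 <= a i) -> (forall i, 0 <= b i) ->
  x ^+ k <= c * \prod_(i in J) a i -> y ^+ k <= c * \prod_(i in J) b i ->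
  (x + y) ^+ k <= c * \prod_(i in J) (a i + b i).
Proof.
move=> kJ c0 x0 y0 a0 b0 xk yk; have /andP[k0 kleJ] := kJ.
have J0 : (0 < #|J|)%N by exact: leq_trans k0 kleJ.
have ab0 i : 0 <= a i + b i by rewrite addr_ge0.
(* If some [a j + b j] vanishes, so do [a j] and [b j], which forces [x = y = 0]. *)
have [/existsP[j /andP[jJ /eqP abj]]|] :=
    boolP [exists j, (j \in J) && (a j + b j == 0)].
  have nul z d : 0 <= z -> z ^+ k <= c * \prod_(i in J) d i -> d j = 0 -> z = 0.
    move=> z0; rewrite (bigD1 j jJ)/= => + dj; rewrite dj mul0r mulr0 => zk.
    have : z ^+ k == 0 by rewrite eq_le zk exprn_ge0.
    by rewrite expf_eq0 k0 => /eqP.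
  move: abj => /eqP; rewrite paddr_eq0// => /andP[/eqP aj /eqP bj].
  rewrite (nul x a)// (nul y b)// addr0 expr0n gtn_eqF//.
  by rewrite mulr_ge0// prodr_ge0.
rewrite negb_exists => /forallP abn0.
have {}abn0 i : i \in J -> a i + b i != 0.
  by move=> iJ; have := abn0 i; rewrite iJ.
set P := \prod_(i in J) (a i + b i); have P0 : 0 <= P by exact: prodr_ge0.
have cP0 : 0 <= c * P by rewrite mulr_ge0.
set r := (c * P) `^ k%:R^-1; have r0 : 0 <= r by exact: powR_ge0.
have rk : r ^+ k = c * P.
  by rewrite -powR_mulrn// -powRrM mulVf ?pnatr_eq0 -?lt0n// powRr1.
have main z d : (forall i, 0 <= d i) -> (forall i, d i <= a i + b i) -> 0 <= z ->
    z ^+ k <= c * \prod_(i in J) d i ->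
    z <= r * ((\sum_(i in J) d i / (a i + b i)) / #|J|%:R).
  move=> d0 dab z0 zk.
  have q01 : {in J, forall i, 0 <= d i / (a i + b i) <= 1}.
    move=> i iJ; rewrite divr_ge0//= ler_pdivrMr ?mul1r//.
    by rewrite lt_def abn0/=.
  rewrite -(@ler_pXn2r _ k)// ?nnegrE//; last first.
    by rewrite mulr_ge0// divr_ge0// sumr_ge0// => i /q01/andP[].
  rewrite exprMn rk; apply: (le_trans zk); rewrite -mulrA ler_wpM2l//.
  have -> : \prod_(i in J) d i = P * \prod_(i in J) (d i / (a i + b i)).
    rewrite -big_split/=; apply: eq_bigr => i iJ.
    by rewrite mulrC divfK// abn0.
  by rewrite ler_wpM2l// prod_le_mean.
rewrite -rk ler_pXn2r ?nnegrE ?addr_ge0//.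
apply: (le_trans (lerD (main x a a0 _ x0 xk) (main y b b0 _ y0 yk))).
- by move=> i; rewrite lerDl.
- by move=> i; rewrite lerDr.
rewrite -mulrDr -mulrDl -big_split/= ler_piMr//.
rewrite (eq_bigr (fun=> 1)); last by move=> i iJ; rewrite -mulrDl divff ?abn0.
by rewrite sumr_const divff// pnatr_eq0 -lt0n.
Qed.

Definition traces (K : choiceType) (A : {fset {fset K}}) (T : {fset K}) :=
  [fset P `&` T | P in A].

(** As [s] is in [T], a trace on [T] records membership of [s], so the two halves of [A] have
    disjoint sets of traces. *)
Lemma traces_splitE (K : choiceType) (A : {fset {fset K}}) (T : {fset K}) (s : K) :
  s \in T ->
  #|` traces A T| = (#|` traces [fset P in A | s \in P] T|
                     + #|` traces [fset P in A | s \notin P] T|)%N.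
Proof.
move=> sT; rewrite -cardfsUI [X in (_ + #|` X|)%N](_ : _ = fset0).
  rewrite cardfs0 addn0; congr #|` _|; apply/fsetP => Q; rewrite inE.
  apply/imfsetP/orP => [[P/= PA ->]|[]/imfsetP[P/=]].
  - have [sP|sP] := boolP (s \in P); [left|right]; apply/imfsetP;
      by exists P => //; rewrite !inE/= PA.
  - by rewrite !inE => /andP[PA _] ->; exists P.
  - by rewrite !inE => /andP[PA _] ->; exists P.
apply/fsetP => Q; rewrite !inE; apply/negP => /andP[].
move=> /imfsetP[P/=]; rewrite !inE/= => /andP[_ sP] -> /imfsetP[P'/=].
rewrite !inE/= => /andP[_ sP'] /fsetP/(_ s).
by rewrite !inE sT (negbTE sP') sP.
Qed.

Lemma traces_sub_card (K : choiceType) (A B : {fset {fset K}}) (T : {fset K}) :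
  A `<=` B -> (#|` traces A T| <= #|` traces B T|)%N.
Proof.
move=> AB; apply/fsubset_leq_card/fsubsetP => Q /imfsetP[P/= PA ->].
by apply/imfsetP; exists P => //; exact: (fsubsetP AB).
Qed.

(* Being injective on A, the trace on S can be peeled one point at a time: each
   half A_0, A_1 of A (according to membership of s) is still determined by its
   trace on S minus s. *)
Lemma shearer (K : choiceType) (I : finType) (F : I -> {fset K}) (k : nat)
    (S : {fset K}) (A : {fset {fset K}}) :
  (0 < k)%N -> {in A &, injective (fun P => P `&` S)} ->
  (forall s, s \in S -> (k <= #|[pred i | s \in F i]|)%N) ->
  (#|` A|%:R : R) ^+ k <= \prod_i #|` traces A (F i)|%:R.
Proof.
move=> k0; elim/fset1U_rect: S A => [|s S sS IH] A Ainj Fcov.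
  have [->|[P PA]] := fset_0Vmem A.
    by rewrite cardfs0 expr0n gtn_eqF// prodr_ge0.
  have -> : A = [fset P].
    apply/fsetP => Q; rewrite !inE; apply/idP/eqP => [QA|->//].
    by apply: Ainj => //; rewrite !fsetI0.
  rewrite cardfs1 expr1n; apply: (@le_trans _ _ (\prod_(i : I) 1)); first by rewrite big1.
  apply: ler_prod => i _; rewrite ler01/= ler1n cardfs_gt0.
  by apply/fset0Pn; exists (P `&` F i); apply/imfsetP; exists P; rewrite ?inE.
set A1 := [fset P in A | s \in P]; set A0 := [fset P in A | s \notin P].
have AE : #|` A| = (#|` A1| + #|` A0|)%N.
  have -> : A0 = A `\` A1.
    by apply/fsetP => P; rewrite !inE/=; case: (P \in A); case: (s \in P).
  rewrite -[LHS](cardfsID A1 A) (fsetIidPr _)//.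
  by apply/fsubsetP => P; rewrite !inE => /andP[].
have Fcov' t : t \in S -> (k <= #|[pred i | t \in F i]|)%N.
  by move=> tS; apply: Fcov; rewrite !inE tS orbT.
have inj1 : {in A1 &, injective (fun P => P `&` S)}.
  move=> P Q; rewrite !inE/= => /andP[PA sP] /andP[QA sQ] PQ.
  apply: Ainj => //=; rewrite ![_ `&` (_ |` _)]fsetIUr PQ; congr (_ `|` _).
  by apply/fsetP => t; rewrite !inE; case: eqP => [->|]; rewrite ?sP ?sQ ?andbF.
have inj0 : {in A0 &, injective (fun P => P `&` S)}.
  move=> P Q; rewrite !inE/= => /andP[PA sP] /andP[QA sQ] PQ.
  apply: Ainj => //=; rewrite ![_ `&` (_ |` _)]fsetIUr PQ; congr (_ `|` _).
  by apply/fsetP => t; rewrite !inE; case: eqP => [->|]; rewrite ?(negbTE sP) ?(negbTE sQ) ?andbF.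
(* Only the factors with [s] in [F i] split into a sum over the two halves; [c] collects the others,
   bounded by the traces of all of [A]. *)
pose J := [pred i | s \in F i].
pose c : R := \prod_(i | i \notin J) #|` traces A (F i)|%:R.
have half B : {in B &, injective (fun P => P `&` S)} -> B `<=` A ->
    (#|` B|%:R : R) ^+ k <= c * \prod_(i in J) #|` traces B (F i)|%:R.
  move=> Binj BA; apply: (le_trans (IH B Binj Fcov')).
  rewrite (bigID (mem J))/= mulrC ler_wpM2r ?prodr_ge0//.
  by apply: ler_prod => i _; rewrite ler0n ler_nat traces_sub_card.
have := @expD_le_prodD I J k c #|` A1|%:R #|` A0|%:R
  (fun i => #|` traces A1 (F i)|%:R) (fun i => #|` traces A0 (F i)|%:R).
rewrite -natrD -AE => /(_ _ _ _ _ _ _ _ _)/le_trans -> //.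
- by rewrite k0/= Fcov// !inE eqxx.
- exact: prodr_ge0.
- by apply: half => //; apply/fsubsetP => P; rewrite !inE => /andP[].
- by apply: half => //; apply/fsubsetP => P; rewrite !inE => /andP[].
rewrite [leRHS](bigID (mem J))/= mulrC ler_wpM2r ?prodr_ge0//.
by apply: ler_prod => i sFi; rewrite addr_ge0//= -natrD (@traces_splitE _ A _ s).
Qed.
(** Shearer's inequality for the cover by [S] and [T], with multiplicity 1. *)
Lemma card_traces2 (K : choiceType) (S T : {fset K}) (A : {fset {fset K}}) :
  (forall P, P \in A -> P `<=` S `|` T) ->
  (#|` A|%:R : R) <= #|` traces A S|%:R * #|` traces A T|%:R.
Proof.
move=> AST; have cov s : s \in S `|` T ->
    (1 <= #|[pred b : bool | s \in if b then S else T]|)%N.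
  by rewrite inE => /orP[] sST; apply/card_gt0P; [exists true|exists false].
have Ainj : {in A &, injective (fun P => P `&` (S `|` T))}.
  by move=> P Q /AST/fsetIidPl PE /AST/fsetIidPl QE; rewrite PE QE.
have := @shearer _ _ (fun b : bool => if b then S else T) 1 _ _ isT Ainj cov.
rewrite expr1 => /le_trans-> //.
rewrite (bigID idfun)/= (big_pred1 true)/=; last by case.
by rewrite (big_pred1 false)//=; case.
Qed.

End Shearer.

(** * Finite sets, translates and languages *)

Section Finite.
Local Open Scope fset_scope.
Local Open Scope nat_scope.

Lemma card_le_inj (K K' : choiceType) (f : K -> K') (A : {fset K}) (B : {fset K'}) :
  {in A &, injective f} -> (forall a, a \in A -> f a \in B) -> #|` A| <= #|` B|.
Proof.
move=> finj fAB; rewrite -(card_in_imfset imfset_key finj).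
by apply/fsubset_leq_card/fsubsetP => _ /imfsetP[a/= aA ->]; exact: fAB.
Qed.

Lemma card_cover_le (K I : choiceType) (r : seq I) (Q : I -> pred K) (D : {fset K}) :
  (forall g, g \in D -> exists2 i, i \in r & Q i g) ->
  #|` D| <= \sum_(i <- r) #|` [fset g in D | Q i g]|.
Proof.
elim: r D => [|i r IH] D cov.
  have [->//|[g /cov[]//]] := fset_0Vmem D.
rewrite big_cons -[leqLHS](cardfsID [fset g in D | Q i g]) leq_add//.
  by apply/fsubset_leq_card/fsubsetIr.
apply: leq_trans (IH _ _) _.
  move=> g; rewrite !inE/= => /andP[+ gD]; rewrite gD/= => nQ.
  have [j] := cov g gD; rewrite inE => /orP[/eqP->|jr Qj]; last by exists j.
  by rewrite (negbTE nQ).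
apply: leq_sum => j _; apply/fsubset_leq_card/fsubsetP => g.
by rewrite !inE/= => /andP[/andP[_ ->] ->].
Qed.

Lemma cardfs_sig_pred (K : choiceType) (D : {fset K}) (P : pred K) :
  #|[pred g : D | P (val g)]| = #|` [fset g in D | P g]|.
Proof.
by rewrite -sum1_card card_fset_sum1 big_fset/= big_seq_fsetE/=; apply: eq_bigl.
Qed.

End Finite.

Section Translates.
Local Open Scope fset_scope.
Variable G : groupType.
Implicit Types (g : G) (S T : {fset G}).

Definition translate g T : {fset G} := [fset (g * t)%g | t in T].

Lemma mem_translate g T y : (y \in translate g T) = ((g^-1 * y)%g \in T).
Proof.
apply/imfsetP/idP => [[t/= tT ->]|yT]; first by rewrite mulKg.
by exists (g^-1 * y)%g => //; rewrite mulVKg.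
Qed.

Lemma card_translate g T : #|` translate g T| = #|` T|.
Proof. by rewrite card_imfset//; exact: mulgI. Qed.

Lemma translateK g T : translate g^-1%g (translate g T) = T.
Proof. by apply/fsetP => y; rewrite !mem_translate monoid.invgK mulKg. Qed.

Lemma translate_sub g S T :
  reflect {in T, forall t, (g * t)%g \in S} (translate g T `<=` S).
Proof.
apply: (@iffP _ _ _ (@fsubsetP _ _ S)) => TS t; first by move=> tT; apply: TS; rewrite mem_translate mulKg.
by rewrite mem_translate => /TS; rewrite mulVKg.
Qed.

Hypothesis G_infinite : infinite_set [set: G].

Lemma exists_notin S : exists g, g \notin S.
Proof.
apply: contrapT => /forallNP nS; apply: G_infinite.
apply: (@sub_finite_set _ _ [set` S]); last exact: finite_fset.
by move=> g _ /=; apply/negPn/negP/nS.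
Qed.

(** A translate [g T] meets [S] only if [g] is one of the finitely many quotients [s t^-1]. *)
Lemma exists_disjoint_translate S T : exists g, [disjoint translate g T & S].
Proof.
have [g gST] := exists_notin [fset (s * t^-1)%g | s in S, t in T].
exists g; apply/fdisjointP => y; rewrite mem_translate => yT.
apply: contra gST => yS; apply/imfset2P; exists y => //; exists (g^-1 * y)%g => //.
by rewrite invgM monoid.invgK mulVKg.
Qed.

End Translates.

Section Language.
Local Open Scope fset_scope.
Variables (R : realType) (G : groupType) (X : set (config G)).
Implicit Types (g : G) (S T : {fset G}).

(* A pattern on S is encoded by the set of the points of S with value 1. *)
Definition lang S : {fset {fset G}} :=
  [fset P in fpowerset S |
    `[< exists2 x, X x & forall s, s \in S -> x s = (s \in P) >]].

Lemma langP S P :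
  reflect (P `<=` S /\ exists2 x, X x & forall s, s \in S -> x s = (s \in P))
          (P \in lang S).
Proof.
by rewrite !inE/= fpowersetE; apply: (iffP andP) => -[PS /asboolP].
Qed.

Lemma traces_lang S T : T `<=` S -> traces (lang S) T `<=` lang T.
Proof.
move=> /fsubsetP TS; apply/fsubsetP => _ /imfsetP[P/= /langP[_ [x Xx xP]] ->].
apply/langP; split; first exact: fsubsetIr.
by exists x => // t tT; rewrite xP ?TS// inE tT andbT.
Qed.

Lemma lang_inj S U : S `<=` U -> {in lang S &, injective (fun P => P `&` U)}.
Proof.
move=> SU P Q /langP[PS _] /langP[QS _].
by rewrite !(fsetIidPl _) ?(fsubset_trans PS)// (fsubset_trans QS).
Qed.

Lemma card_traces_le (A : {fset {fset G}}) T : (#|` traces A T| <= 2 ^ #|` T|)%N.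
Proof.
rewrite -card_fpowerset; apply/fsubset_leq_card/fsubsetP => _ /imfsetP[P _ ->].
by rewrite fpowersetE fsubsetIr.
Qed.

Lemma card_lang_le S : (#|` lang S| <= 2 ^ #|` S|)%N.
Proof.
rewrite -card_fpowerset; apply/fsubset_leq_card/fsubsetP => P /langP[PS _].
by rewrite fpowersetE.
Qed.

Lemma card_langU S T :
  (#|` lang (S `|` T)|%:R : R) <= #|` lang S|%:R * #|` lang T|%:R.
Proof.
have LP P : P \in lang (S `|` T) -> P `<=` S `|` T by case/langP.
apply: le_trans (card_traces2 R LP) _; rewrite -!natrM ler_nat leq_mul//;
  by apply/fsubset_leq_card/traces_lang; rewrite ?fsubsetUl ?fsubsetUr.
Qed.

Hypothesis X_shift : forall x g, X x -> X (fun y => x (g * y)%g).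

(** In [language] a pattern may appear at any position, in [lang] it must sit on [S] itself; shift
    invariance reconciles the two. *)
Lemma card_language S : #|language X S| = #|` lang S|.
Proof.
pose f (p : {ffun S -> bool}) : {fset G} := [fset val s | s in [pred s : S | p s]].
have fE p (s : S) : (val s \in f p) = p s.
  by apply/imfsetP/idP => [[t/= pt /val_inj->//]|ps]; exists s.
have finj : injective f by move=> p q pq; apply/ffunP => s; rewrite -!fE pq.
suff -> : lang S = [fset f p | p in language X S] by rewrite card_imfset// -cardE.
apply/fsetP => P; apply/langP/imfsetP => [[PS [x Xx xP]]|[p/= + ->]].
  exists [ffun s : S => val s \in P] => /=.
    rewrite inE; apply/asboolP; exists x => //; exists 1%g => s.
    by rewrite mul1g ffunE xP; last exact: valP.
  apply/fsetP => y; have [yS|yS] := boolP (y \in S).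
    by rewrite -[y in RHS]/(val [` yS]) fE ffunE.
  rewrite (contraNF (fsubsetP PS y) yS); apply/esym/negP => /imfsetP[s/= _ ys].
  by move: yS; rewrite ys; case: s {ys} => /= s ->.
rewrite inE => /asboolP[x Xx [g xp]]; split.
  by apply/fsubsetP => _ /imfsetP[s _ ->]; exact: valP.
exists (fun y => x (g * y)%g) => [|s sS]; first exact: X_shift.
by rewrite -[s]/(val [` sS]) xp fE.
Qed.

Lemma card_lang_translate g T : #|` lang (translate g T)| = #|` lang T|.
Proof.
have main h U : (#|` lang (translate h U)| <= #|` lang U|)%N.
  apply: (@card_le_inj _ _ (translate h^-1%g)) => [P Q _ _ /(congr1 (translate h))|P].
    by rewrite -{1 3}[h]monoid.invgK !translateK.
  move=> /langP[PhU [x Xx xP]]; apply/langP; split.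
    apply/translate_sub => p /(fsubsetP PhU); by rewrite mem_translate.
  exists (fun y => x (h * y)%g); first exact: X_shift.
  by move=> s sU; rewrite xP ?mem_translate ?monoid.invgK// mulKg.
by apply/eqP; rewrite eqn_leq main -{1}(translateK g T) main.
Qed.

End Language.

(** * Growth and entropy as an infimum of rates *)

Section Rate.
Local Open Scope fset_scope.
Local Open Scope ring_scope.
Variables (R : realType) (G : groupType) (X : set (config G)).
Hypothesis X_shift : forall x g, X x -> X (fun y => x (g * y)%g).
Hypothesis X_neq0 : exists x, X x.
Implicit Types (S T : {fset G}).

Lemma prod_fset_le (K : choiceType) (D : {fset K}) (F : K -> R) (c : R) :
  (forall i, i \in D -> 0 <= F i <= c) -> \prod_(i <- D) F i <= c ^+ #|` D|.
Proof.
move=> Fc; rewrite -[c ^+ _]iter_mulr_1 -(count_predT D) -big_const_seq.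
by rewrite big_seq [leRHS]big_seq; exact: ler_prod.
Qed.

Lemma card_lang_gt0 S : (0 < #|` lang X S|)%N.
Proof.
have [x Xx] := X_neq0; rewrite cardfs_gt0; apply/fset0Pn.
exists [fset s in S | x s]; apply/langP; split.
  by apply/fsubsetP => s; rewrite !inE => /andP[].
by exists x => // s sS; rewrite !inE sS.
Qed.

(** The elements [s t^-1] put [s] into the translate; their number is the covering multiplicity in
    Shearer's inequality. *)
Lemma card_translates_meeting (S T : {fset G}) :
  let D := [fset (s * t^-1)%g | s in S, t in T] in
  forall s, s \in S -> (#|` T| <= #|` [fset g in D | s \in translate g T]|)%N.
Proof.
move=> D s sS; apply: (@card_le_inj _ _ (fun t => (s * t^-1)%g)).
  by move=> t u _ _ /mulgI/monoid.invg_inj.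
move=> t tT; rewrite !inE/= mem_translate invgM monoid.invgK mulgVK tT andbT.
by apply/imfset2P; exists s => //; exists t.
Qed.

(** Shearer's inequality for the translates of [T] that meet [S]. Those inside [S] number at most
    [#|S|], as [g] is sent to [g t0] in [S]. Each of the others has at most [2 ^ #|T|] traces, and
    the double sum bounds their number: such a [g] has [g t] in [S] and [g u] outside for some [t],
    [u] in [T]. *)
Lemma card_lang_shearer (S T : {fset G}) :
  T != fset0 -> [fset (s^-1)%g | s in S] = S ->
  (#|` lang X S|%:R : R) ^+ #|` T| <=
  #|` lang X T|%:R ^+ #|` S| *
  2 ^+ (#|` T| * \sum_(t <- T) \sum_(u <- T) #|` translate (u^-1 * t)%g S `\` S|)%N.
Proof.
move=> T0 Ssym; set D := [fset (s * t^-1)%g | s in S, t in T].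
pose inner := [fset g in D | translate g T `<=` S].
pose outer := [fset g in D | ~~ (translate g T `<=` S)].
have Tgt0 : (0 < #|` T|)%N by rewrite cardfs_gt0.
have [t0 t0T] : exists t, t \in T by exact/fset0Pn.
have innerS : (#|` inner| <= #|` S|)%N.
  apply: (@card_le_inj _ _ (fun g => (g * t0)%g)); first by move=> g h _ _ /mulIg.
  by move=> g; rewrite !inE/= => /andP[_ /translate_sub]; exact.
have outerS : (#|` outer| <=
    \sum_(t <- T) \sum_(u <- T) #|` translate (u^-1 * t)%g S `\` S|)%N.
  pose Q (p : G * G) g := ((g * p.1)%g \in S) && ((g * p.2)%g \notin S).
  apply: (@leq_trans (\sum_(p <- [seq (t, u) | t <- T, u <- T])
                        #|` [fset g in outer | Q p g]|)).
    apply: card_cover_le => g; rewrite !inE/= => /andP[/imfset2P[s/= sS [t/= tT ->]]].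
    rewrite -fsetD_eq0 => /fset0Pn[y]; rewrite inE mem_translate => /andP[yS].
    set u := (_ * y)%g => uT; exists (t, u).
      by apply/allpairsP; exists (t, u).
    by rewrite /Q/= mulgVK sS/= /u mulVKg.
  rewrite big_allpairs; apply: leq_sum => t _; apply: leq_sum => u _.
  (* Symmetry of [S] turns a right translation into a left one: [(g u)^-1] is [u^-1 t] times
     [(g t)^-1], so it lies in [(u^-1 t) S] but not in [S]. *)
  have SV s : (s^-1%g \in S) = (s \in S).
    rewrite -{1}Ssym; apply/imfsetP/idP => [[v/= vS /monoid.invg_inj->//]|sS].
    by exists s.
  apply: (@card_le_inj _ _ (fun g => (g * u)^-1)%g).
    by move=> g h _ _ /monoid.invg_inj/mulIg.
  move=> g; rewrite /Q !inE/= => /andP[_ /andP[gt gu]].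
  rewrite SV gu/= mem_translate -SV; congr (_ \in S): gt.
  by rewrite invgM !monoid.invgK mulgA mulgK.
have cov s : s \in S -> (#|` T| <= #|[pred g : D | s \in translate (val g) T]|)%N.
  by move=> sS; rewrite (@cardfs_sig_pred _ D (fun g => s \in translate g T)) card_translates_meeting.
have /le_trans := @shearer R G D (fun g => translate (val g) T) #|` T| S (lang X S)
  Tgt0 (lang_inj (fsubset_refl _)) cov.
apply; rewrite -(@big_seq_fsetE _ _ _ _ D predT
  (fun g => #|` traces (lang X S) (translate g T)|%:R))/=.
rewrite (big_fsetID _ (fun g => translate g T `<=` S))/=.
apply: ler_pM; rewrite ?prodr_ge0//.
  apply: (@le_trans _ _ (#|` lang X T|%:R ^+ #|` inner|)); last first.
    by rewrite ler_weXn2l// ler1n card_lang_gt0.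
  apply: prod_fset_le => g; rewrite !inE/= ler0n ler_nat => /andP[_ gTS].
  rewrite -(card_lang_translate X_shift g).
  exact/fsubset_leq_card/traces_lang.
apply: (@le_trans _ _ ((2 ^+ #|` T|) ^+ #|` outer|)).
  apply: prod_fset_le => g _; rewrite ler0n -natrX ler_nat.
  by rewrite -(card_translate g) card_traces_le.
by rewrite -exprM ler_weXn2l ?ler1n// leq_mul2l outerS orbT.
Qed.

Hypothesis G_infinite : infinite_set [set: G].

(* Disjoint translates of T, completed by fewer than |T| points. *)
Lemma exists_small_lang (T : {fset G}) (n : nat) : T != fset0 ->
  exists2 S : {fset G}, #|` S| = n &
    (#|` lang X S|%:R : R) <=
    #|` lang X T|%:R ^+ (n %/ #|` T|) * 2 ^+ (n %% #|` T|).
Proof.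
move=> T0; suff main q r : exists2 S : {fset G}, #|` S| = (q * #|` T| + r)%N &
    (#|` lang X S|%:R : R) <= #|` lang X T|%:R ^+ q * 2 ^+ r.
  have [S SE lS] := main (n %/ #|` T|)%N (n %% #|` T|)%N.
  by exists S => //; rewrite SE -divn_eq.
have step (S U : {fset G}) : exists2 S' : {fset G}, #|` S'| = (#|` S| + #|` U|)%N &
    (#|` lang X S'|%:R : R) <= #|` lang X S|%:R * #|` lang X U|%:R.
  have [g gUS] := exists_disjoint_translate G_infinite S U.
  exists (S `|` translate g U).
    move: gUS; rewrite fdisjoint_sym -fsetI_eq0 => /eqP gUS.
    by rewrite cardfsU gUS cardfs0 subn0 card_translate.
  by rewrite -(card_lang_translate X_shift g U); exact: card_langU.
elim: r => [|r [S SE lS]].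
  elim: q => [|q [S SE lS]].
    exists fset0; first by rewrite cardfs0.
    by rewrite !expr0 mulr1 lern1 (leq_trans (card_lang_le _ _))// cardfs0.
  have [S' S'E lS'] := step S T; exists S'; first by rewrite S'E SE; lia.
  apply: (le_trans lS'); rewrite exprSr mulrAC ler_wpM2r//.
have [S' S'E lS'] := step S [fset 1%g]; exists S'.
  by rewrite S'E SE cardfs1; lia.
apply: (le_trans lS'); rewrite exprSr mulrA ler_pM//.
by rewrite (ler_nat _ _ 2) (leq_trans (card_lang_le _ _))// cardfs1.
Qed.

Definition ent S : R := ln #|` lang X S|%:R.
Definition rate S : R := ent S / #|` S|%:R.
Definition rate_inf : R := inf [set rate S | S in [set S | S != fset0]].

Lemma ent_ge0 S : 0 <= ent S.
Proof. by rewrite ln_ge0// ler1n card_lang_gt0. Qed.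

Lemma rate_ge0 S : 0 <= rate S.
Proof. by rewrite divr_ge0// ent_ge0. Qed.

Lemma rate_inf_le S : S != fset0 -> rate_inf <= rate S.
Proof.
move=> S0; apply: ge_inf; last by exists S.
by exists 0 => _ [T _ <-]; exact: rate_ge0.
Qed.

Lemma rate_inf_approx (e : R) : 0 < e ->
  exists2 T, T != fset0 & rate T < rate_inf + e.
Proof.
move=> e0; have [|_ [T T0 <-] Te] :=
  @inf_adherent R [set rate S | S in [set S | S != fset0]] e e0.
  split; last by exists 0 => _ [T _ <-]; exact: rate_ge0.
  exists (rate [fset 1%g]), [fset 1%g] => //=.
  by apply/fset0Pn; exists 1%g; rewrite inE.
by exists T.
Qed.

Lemma rate_cvg (S : nat -> {fset G}) : symmetric_folner R S ->
  (fun n => rate (S n)) @ \oo --> rate_inf.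
Proof.
move=> [[S0 SF] Ssym]; apply/cvgrPdist_le => e e0.
have [T T0 Te] := rate_inf_approx (divr_gt0 e0 (ltr0n R 2)).
(* The logarithm of the power of 2 in [card_lang_shearer], divided by [#|T|] and [#|S n|]; each term
   tends to 0 by the Folner condition. *)
pose v n : R := ln 2 * \sum_(t <- T) \sum_(u <- T)
  (#|` translate (u^-1 * t)%g (S n) `\` S n|%:R / #|` S n|%:R).
have v0 : v @ \oo --> (0 : R).
  rewrite [X in _ --> X](_ : _ = ln 2 * \sum_(t <- T) \sum_(u <- T) 0); last first.
    by rewrite big1 ?mulr0// => t _; rewrite big1.
  apply: cvgMl_tmp; apply: cvg_big => [|t _]; first exact: add_continuous.
  apply: cvg_big => [|u _]; first exact: add_continuous.
  apply: squeeze_cvgr (cvg_cst 0) (SF (u^-1 * t)%g); near=> n.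
  rewrite divr_ge0//= ler_wpM2r ?invr_ge0// ler_nat.
  exact/fsubset_leq_card/fsubsetUl.
near=> n.
have Sn0 : 0 < #|` S n|%:R :> R by rewrite ltr0n cardfs_gt0 S0.
have Tn0 : 0 < #|` T|%:R :> R by rewrite ltr0n cardfs_gt0.
rewrite distrC ger0_norm ?subr_ge0 ?rate_inf_le// lerBlDl.
have vn : v n <= e / 2.
  near: n; apply: (cvgr_le 0) => //; exact: divr_gt0.
suff : rate (S n) <= rate T + v n by lra.
set N := (\sum_(t <- T) \sum_(u <- T) #|` translate (u^-1 * t)%g (S n) `\` S n|)%N.
have -> : v n = ln 2 * N%:R / #|` S n|%:R.
  rewrite /v /N natr_sum -mulrA; congr (_ * _); rewrite mulr_suml.
  by apply: eq_bigr => t _; rewrite natr_sum mulr_suml.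
have L0 U : 0 < #|` lang X U|%:R :> R by rewrite ltr0n card_lang_gt0.
have := @card_lang_shearer (S n) T T0 (Ssym n); rewrite -/N.
rewrite -ler_ln ?posrE ?mulr_gt0 ?exprn_gt0// lnM ?posrE ?exprn_gt0// !lnXn//.
rewrite -[leLHS]mulr_natl -[X in _ <= X + _]mulr_natl.
rewrite -[X in _ <= _ + X]mulr_natl natrM -!/(ent _) => H.
rewrite /rate -(ler_pM2r Sn0) divfK ?gt_eqF// -(ler_pM2r Tn0).
apply: le_trans (_ : #|` S n|%:R * ent T + #|` T|%:R * N%:R * ln 2 <= _).
  by rewrite mulrC.
by rewrite le_eqVlt; apply/orP; left; apply/eqP; field; rewrite !gt_eqF.
Unshelve. all: by end_near. Qed.

Lemma le_min_complexity (n : nat) :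
  (0 < n)%N -> expR (rate_inf * n%:R) <= min_complexity R X n.
Proof.
move=> n0; apply: lb_le_inf.
  (* An infimum is bounded below this way only over a nonempty set, so some set of size [n] has to
     be exhibited. *)
  have T0 : [fset 1%g : G] != fset0 by apply/fset0Pn; exists 1%g; rewrite inE.
  have [S SE _] := @exists_small_lang _ n T0.
  by exists (#|language X S|%:R), S.
move=> _ [S /= SE <-]; rewrite card_language//.
have L0 : 0 < #|` lang X S|%:R :> R by rewrite ltr0n card_lang_gt0.
rewrite -[leRHS](@lnK _ _) ?posrE// ler_expR -SE -ler_pdivlMr ?ltr0n ?SE//.
by rewrite -SE; apply: rate_inf_le; rewrite -cardfs_gt0 SE.
Qed.

Lemma min_complexity_le (S : {fset G}) :
  min_complexity R X #|` S| <= #|` lang X S|%:R.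
Proof.
rewrite -card_language//; apply: ge_inf; last by exists S.
by exists 0 => _ [T _ <-].
Qed.

(** After taking logarithms, the sequence lies between [rate_inf] and [rate T + #|T| ln 2 / n] for a
    near-optimal [T]: the fewer than [#|T|] leftover points cost at most [ln 2] each. *)
Lemma growth_cvg : growth_seq R X @ \oo --> expR rate_inf.
Proof.
pose w n : R := ln (min_complexity R X n) / n%:R.
(* [powR] is defined by cases at base 0; positivity makes it the exponential of a logarithm. *)
have mc0 n : (0 < n)%N -> 0 < min_complexity R X n.
  by move=> n0; apply: lt_le_trans (le_min_complexity n0); exact: expR_gt0.
suff wc : w @ \oo --> rate_inf.
  have expw : expR (w n) @[n --> \oo] --> expR rate_inf.
    by apply: continuous_cvg => //; exact: continuous_expR.
  apply: cvg_trans expw; apply: near_eq_cvg; near=> n.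
  have n0 : (0 < n)%N by near: n; exact: nbhs_infty_gt.
  by rewrite /= /growth_seq /powR gt_eqF ?mc0// /w mulrC.
apply/cvgrPdist_le => e e0.
have [T T0 Te] := rate_inf_approx (divr_gt0 e0 (ltr0n R 2)).
have Tn0 : 0 < #|` T|%:R :> R by rewrite ltr0n cardfs_gt0.
near=> n.
have n0 : (0 < n)%N by near: n; exact: nbhs_infty_gt.
have nr0 : 0 < n%:R :> R by rewrite ltr0n.
have wge : rate_inf <= w n.
  rewrite ler_pdivlMr// -[leLHS]expRK ler_ln ?posrE ?expR_gt0 ?mc0//.
  exact: le_min_complexity.
rewrite distrC ger0_norm ?subr_ge0// lerBlDl.
have nbig : #|` T|%:R * ln 2 <= e / 2 * n%:R.
  rewrite -ler_pdivrMl ?divr_gt0//; near: n; exact: nbhs_infty_ger.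
suff : w n <= rate T + #|` T|%:R * ln 2 / n%:R.
  have : #|` T|%:R * ln 2 / n%:R <= e / 2 by rewrite ler_pdivrMr.
  lra.
have [S SE lS] := @exists_small_lang T n T0.
have L0 U : 0 < #|` lang X U|%:R :> R by rewrite ltr0n card_lang_gt0.
have := le_trans (min_complexity_le S) lS; rewrite SE.
rewrite -ler_ln ?posrE ?mulr_gt0 ?exprn_gt0 ?mc0// lnM ?posrE ?exprn_gt0// !lnXn//.
rewrite -[X in _ <= X + _]mulr_natl -[X in _ <= _ + X]mulr_natl -/(ent T) => H.
rewrite /w ler_pdivrMr//; apply: (le_trans H).
rewrite mulrDl divfK ?gt_eqF//; apply: lerD; last first.
  by rewrite ler_wpM2r ?ln_ge0 ?ler1n// ler_nat ltnW// ltn_mod cardfs_gt0.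
rewrite /rate mulrAC ler_pdivlMr// mulrAC [leRHS]mulrC ler_wpM2r ?ent_ge0//.
by rewrite -natrM ler_nat leq_divM.
Unshelve. all: by end_near. Qed.

End Rate.

(** * Counting the patterns of the aperiodic subshift *)

Lemma sum_dyadic_le1 (R : realType) (r : seq nat) :
  uniq r -> \sum_(i <- r) (2^-1 : R) ^+ i.+1 <= 1.
Proof.
move=> ur; have [m rm] : exists m, all (fun i => (i < m)%N) r.
  by exists (\max_(i <- r) i).+1; apply/allP => i ir; rewrite ltnS; exact: leq_bigmax_seq.
(* The sharper bound leaves room for the term of index [m] in the induction on [m]. *)
suff : \sum_(i <- r) (2^-1 : R) ^+ i.+1 <= 1 - 2^-1 ^+ m.
  by move/le_trans; apply; rewrite gerBl exprn_ge0.
elim: m r ur rm => [|m IH] r ur rm.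
  by case: r rm {ur} => //= _; rewrite big_nil expr0 subrr.
have step s : uniq s -> all (fun i => (i < m.+1)%N) s -> m \notin s ->
    \sum_(i <- s) (2^-1 : R) ^+ i.+1 <= 1 - 2^-1 ^+ m.
  move=> us sm ms; apply: IH => //; apply/allP => i is_; have := allP sm i is_.
  by rewrite ltnS leq_eqVlt => /orP[/eqP im|//]; rewrite -im is_ in ms.
have E : (2^-1 : R) ^+ m = 2^-1 ^+ m.+1 + 2^-1 ^+ m.+1 by rewrite exprS; lra.
have [mr|mr] := boolP (m \in r); last first.
  by apply: (le_trans (step _ ur rm mr)); rewrite E opprD addrA gerBl exprn_ge0.
have {}step : \sum_(i <- rem m r) (2^-1 : R) ^+ i.+1 <= 1 - 2^-1 ^+ m.
  apply: step; rewrite ?rem_uniq ?mem_rem_uniqF//.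
  by apply/allP => i /mem_rem; exact: (allP rm).
by rewrite (big_rem m)//=; lra.
Qed.

Section Construction.
Local Open Scope fset_scope.
Local Open Scope ring_scope.
Variables (R : realType) (G : groupType) (T : G -> {fset G}).
Implicit Types (S P Q : {fset G}).

Definition distinguishing : set (config G) :=
  [set x | forall g k : G, g != 1%g ->
     exists2 t, t \in T g & x (k * t)%g != x (k * g * t)%g].

Lemma distinguishing_shift (x : config G) (h : G) :
  distinguishing x -> distinguishing (fun y => x (h * y)%g).
Proof.
by move=> Xx g k g1; have [t tT xt] := Xx g (h * k)%g g1; exists t; rewrite // !mulgA.
Qed.

Lemma distinguishing_aperiodic : strongly_aperiodic distinguishing.
Proof.
move=> x Xx g xg; apply/eqP; apply: contraT => g1.
by have [t _] := Xx g 1%g g1; rewrite !mul1g -xg eqxx.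
Qed.

Lemma distinguishing_subshift : (forall g, g != 1%g -> T g != fset0) ->
  is_subshift distinguishing.
Proof.
move=> T0; exists [set p : pattern G | exists g, [/\ g != 1%g,
  supp p = T g `|` translate g (T g) & exists2 y : config G,
  (forall s, p s = y (val s)) & forall t, t \in T g -> y t = y (g * t)%g]].
apply/seteqP; split => [x Xx p/= [g [g1 pT [y py yT]]] [k xp]|x/= avoid g k g1].
  have [t tT] := Xx g k g1.
  have tp : t \in supp p by rewrite pT inE tT.
  have gtp : (g * t)%g \in supp p by rewrite pT inE mem_translate mulKg tT orbT.
  have := xp [` tp]; have := xp [` gtp]; rewrite !py/= mulgA => -> ->.
  by rewrite yT// eqxx.
apply: contrapT => nt; pose W := T g `|` translate g (T g).
have W0 : W != fset0.
  by have /fset0Pn[t tT] := T0 g g1; apply/fset0Pn; exists t; rewrite inE tT.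
apply: (avoid (Pattern W0 [ffun s => x (k * val s)%g])) => /=.
  exists g; split => //; exists (fun y => x (k * y)%g) => [s|t tT].
    by rewrite ffunE.
  apply/eqP; rewrite mulgA; apply: contraPT nt => xt.
  by rewrite notE; exists t.
by exists k => s; rewrite ffunE.
Qed.

Definition good S P := forall g k : G, g != 1%g ->
  {in T g, forall t, (k * t)%g \in S /\ (k * g * t)%g \in S} ->
  exists2 t, t \in T g & ((k * t)%g \in P) != ((k * g * t)%g \in P).

Definition goods S : {fset {fset G}} := [fset P in fpowerset S | `[< good S P >]].

Lemma goodsP S P : reflect (P `<=` S /\ good S P) (P \in goods S).
Proof. by rewrite !inE/= fpowersetE; apply: (iffP andP) => -[PS /asboolP]. Qed.

Lemma good_agree S S' P P' : S' `<=` S ->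
  {in S', forall s, (s \in P) = (s \in P')} -> good S P -> good S' P'.
Proof.
move=> /fsubsetP SS PP gP g k g1 kS.
have [t tT tP] : exists2 t, t \in T g & ((k * t)%g \in P) != ((k * g * t)%g \in P).
  by apply: gP => // t /kS[/SS ? /SS].
by exists t => //; have [kt kgt] := kS _ tT; rewrite -!PP.
Qed.

Lemma goods_restrict S S' P : S' `<=` S -> P \in goods S -> P `&` S' \in goods S'.
Proof.
move=> SS /goodsP[_ gP]; apply/goodsP; split; first exact: fsubsetIr.
by apply: good_agree SS _ gP => s sS; rewrite inE sS andbT.
Qed.

(* The values of a pattern of B on A are recovered from those on sigma A. *)
Lemma card_repeating_le S A (sigma : G -> G) (s : G) (B : {fset {fset G}}) :
  s \in A -> A `<=` s |` S -> {in A, forall a, sigma a \in S `\` A} ->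
  (forall Q, Q \in B -> [/\ Q `<=` s |` S, good S Q &
                            {in A, forall a, (a \in Q) = (sigma a \in Q)}]) ->
  (#|` B| <= #|` goods (S `\` A)|)%N.
Proof.
move=> sA AS sigA BP; apply: (@card_le_inj _ _ (fun Q => Q `&` (S `\` A))).
  move=> P Q /BP[PS _ Psig] /BP[QS _ Qsig] /fsetP PQ; apply/fsetP => y.
  have out z : z \in S `\` A -> (z \in P) = (z \in Q).
    by move=> zSA; have := PQ z; rewrite !inE -in_fsetD zSA !andbT.
  have [yA|yA] := boolP (y \in A); first by rewrite Psig// Qsig// out// sigA.
  have [yS|yS] := boolP (y \in S); first by rewrite out// inE yA.
  have yn : y \notin s |` S by rewrite !inE negb_or yS andbT; apply: contraNneq yA => ->.
  by rewrite (contraNF (fsubsetP PS y) yn) (contraNF (fsubsetP QS y) yn).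
move=> Q /BP[QS gQ _]; apply/goodsP; split; first exact: fsubsetIr.
apply: good_agree gQ; first exact: fsubsetDl.
by move=> z zSA; rewrite inE zSA andbT.
Qed.

Variables (b : R) (f : G -> nat).
Hypotheses (b_gt1 : 1 < b) (b_lt2 : b < 2) (f_inj : injective f).
Hypothesis T_disjoint :
  forall g, g != 1%g -> {in T g, forall t, (g * t)%g \notin T g}.
Hypothesis T_weight : forall g, g != 1%g ->
  2 * #|` T g|%:R / b ^+ #|` T g|.-1 <= (2 - b) * 2^-1 ^+ (f g).+1.

Let b_gt0 : 0 < b. Proof. exact: lt_trans ltr01 b_gt1. Qed.

Lemma goods_chain S D m :
  (forall S' s, (#|` S'| < m)%N -> s \notin S' ->
     b * #|` goods S'|%:R <= #|` goods (s |` S')|%:R) ->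
  (#|` D `|` S| <= m)%N -> [disjoint D & S] ->
  b ^+ #|` D| * #|` goods S|%:R <= #|` goods (D `|` S)|%:R.
Proof.
move=> grow; elim/fset1U_rect: D => [|s D sD IH] mDS DS.
  by rewrite cardfs0 expr0 mul1r fset0U.
have sS : s \notin S by apply: (fdisjointP DS); rewrite !inE eqxx.
have sDS : s \notin D `|` S by rewrite inE negb_or sD.
have cDS : (#|` D `|` S| < m)%N by move: mDS; rewrite -fsetUA cardfsU1 sDS.
rewrite cardfsU1 sD exprS -mulrA -fsetUA; apply: le_trans (grow _ s cDS sDS).
rewrite ler_pM2l//; apply: IH; first exact: ltnW.
by apply/fdisjointP => y yD; apply: (fdisjointP DS); rewrite !inE yD orbT.
Qed.

(* Every violation of goodness created by s is of this form, the boolean telling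
   which of the two translates of T g contains s. *)
Definition repeating S (s g : G) (ct : bool * G) Q :=
  let k := (s * ct.2^-1)%g in let h := if ct.1 then g else g^-1%g in
  [/\ ct.2 \in T g, Q `<=` s |` S, good S Q &
    {in T g, forall u, [/\ (k * u)%g \in s |` S, (k * h * u)%g \in s |` S &
                           ((k * u)%g \in Q) = ((k * h * u)%g \in Q)]}].

Lemma card_repeating S (s g : G) (ct : bool * G) (B : {fset {fset G}}) :
  (forall S' s', (#|` S'| < #|` S|)%N -> s' \notin S' ->
     b * #|` goods S'|%:R <= #|` goods (s' |` S')|%:R) ->
  s \notin S -> g != 1%g -> (forall Q, Q \in B -> repeating S s g ct Q) ->
  #|` B|%:R <= #|` goods S|%:R / b ^+ #|` T g|.-1.
Proof.
move=> grow sS g1 Brep.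
have [->|[Q0 Q0B]] := fset_0Vmem B.
  by rewrite cardfs0 divr_ge0// exprn_ge0// ltW.
case: ct Brep => c t Brep.
have [/= tT _ _ Q0T] := Brep _ Q0B.
set k := (s * t^-1)%g in Q0T *.
pose h := if c then g else g^-1%g.
pose A := translate k (T g); pose sigma a := (k * h * k^-1 * a)%g.
have sA : s \in A by rewrite mem_translate /k invgM monoid.invgK mulgVK.
have AS : A `<=` s |` S by apply/translate_sub => u /Q0T[].
have sigmaE u : sigma (k * u)%g = (k * h * u)%g by rewrite /sigma mulgA mulgVK.
have sigA : {in A, forall a, sigma a \in S `\` A}.
  move=> _ /imfsetP[u/= uT ->]; rewrite sigmaE; have [_ + _] := Q0T u uT.
  have nA : (k * h * u)%g \notin A.
    rewrite mem_translate -(mulgA k) mulKg /h; case: (c); first exact: T_disjoint.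
    by apply: contraL uT => /(T_disjoint g1); rewrite mulVKg.
  rewrite !inE nA/= => /orP[/eqP kus|//]; by rewrite kus sA in nA.
have BA : (#|` B| <= #|` goods (S `\` A)|)%N.
  apply: (card_repeating_le sA AS sigA) => Q /Brep[/= _ QS gQ QT]; split=> //.
  by move=> _ /imfsetP[u/= uT ->]; rewrite sigmaE; have [_ _] := QT u uT.
have DA : (S `&` A) `|` (S `\` A) = S.
  by apply/fsetP => y; rewrite !inE; case: (y \in A); rewrite ?andbT ?andbF ?orbF.
have cD : #|` S `&` A| = #|` T g|.-1.
  rewrite -(card_translate k (T g)) -/A (cardfsD1 s A) sA /=; congr (size (enum_fset _)).
  apply/fsetP => y; rewrite !inE; have [yA|] := boolP (y \in A); last by rewrite !andbF.
  have := fsubsetP AS y yA; rewrite !inE !andbT.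
  by have [->|] := eqVneq y s; rewrite ?(negbTE sS).
have := @goods_chain (S `\` A) (S `&` A) #|` S| grow; rewrite DA cD.
move=> /(_ (leqnn _)) chain.
rewrite ler_pdivlMr ?exprn_gt0// mulrC; apply: le_trans (chain _).
  by rewrite ler_pM2l ?exprn_gt0// ler_nat.
by apply/fdisjointP => y; rewrite !inE => /andP[_ ->].
Qed.

Lemma bad_repeating S (s : G) Q : s \notin S -> Q `<=` s |` S -> good S Q ->
  ~ good (s |` S) Q -> exists2 g, g != 1%g & exists ct, repeating S s g ct Q.
Proof.
move=> sS QS gQ; apply: contra_notP => /forall2NP norep g k g1 kS.
apply: contrapT => /forall2NP same.
have {}same t : t \in T g -> ((k * t)%g \in Q) = ((k * g * t)%g \in Q).
  by move=> tT; have [//|/negP] := same t; rewrite negbK => /eqP.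
have [//|norep_g] := norep g.
have [|t tT] := gQ g k g1.
  move=> t tT; have [kt kgt] := kS t tT; split.
    move: kt; rewrite !inE => /orP[/eqP kts|//]; case: norep_g.
    have ks : (s * t^-1)%g = k by rewrite -kts mulgK.
    exists (true, t); rewrite /repeating/= ks; split=> // u uT.
    by have [] := kS u uT; split=> //; exact: same.
  move: kgt; rewrite !inE => /orP[/eqP kts|//]; case: norep_g.
  have ks : (s * t^-1)%g = (k * g)%g by rewrite -kts mulgK.
  exists (false, t); rewrite /repeating/= ks; split=> // u uT.
  by rewrite mulgK; have [] := kS u uT; split=> //; rewrite same.
by rewrite same// eqxx.
Qed.

Lemma goods_grow S (s : G) : s \notin S ->
  b * #|` goods S|%:R <= #|` goods (s |` S)|%:R.
Proof.
have [m Sm] := ubnP #|` S|; elim: m S s Sm => // m IH S s Sm sS.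
have {}IH S' s' : (#|` S'| < #|` S|)%N -> s' \notin S' ->
     b * #|` goods S'|%:R <= #|` goods (s' |` S')|%:R.
  by move=> S'S; apply: IH; exact: leq_trans S'S _.
have [E EP] : exists E : {fset {fset G}},
    forall Q, Q \in E <-> Q `<=` s |` S /\ good S Q.
  exists [fset Q in fpowerset (s |` S) | `[< good S Q >]] => Q.
  rewrite !inE/= fpowersetE.
  by split=> [/andP|] [QS /asboolP gQ]; first split; rewrite ?QS.
have {}EP Q : reflect (Q `<=` s |` S /\ good S Q) (Q \in E).
  by apply: (iffP idP) => /EP.
pose B := [fset Q in E | ~~ `[< good (s |` S) Q >]].
have goodE : #|` E| = (#|` goods (s |` S)| + #|` B|)%N.
  rewrite -[LHS](cardfsID (goods (s |` S)) E) (fsetIidPr _); last first.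
    apply/fsubsetP => Q /goodsP[QS gQ]; apply/EP; split=> //.
    by apply: good_agree gQ => //; exact: fsubsetUr.
  congr (_ + size (enum_fset _))%N; apply/fsetP => Q; rewrite !inE/= fpowersetE.
  by case: EP => [[-> _]|]; rewrite ?andbF ?andbT.
have E2 : (2 * #|` goods S| <= #|` E|)%N.
  have sPF P : P `<=` S -> (s \in P) = false.
    by move=> PS; apply: contraNF sS; exact: (fsubsetP PS).
  rewrite -(cardfsID [fset Q in E | s \in Q] E) mul2n -addnn; apply: leq_add.
    apply: (@card_le_inj _ _ (fun P => s |` P)) => [P Q|P].
      move=> /goodsP[PS _] /goodsP[QS _] PQ.
      by rewrite -(fsetU1K (negbT (sPF P PS))) PQ fsetU1K ?sPF.
    move=> /goodsP[PS gP].
    have sPE : s |` P \in E.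
      apply/EP; split; first by rewrite fsetUS.
      apply: good_agree gP => // y yS; rewrite !inE.
      by have [ys|//] := eqVneq y s; rewrite ys (negbTE sS) in yS.
    by rewrite !inE/= sPE eqxx.
  apply: fsubset_leq_card; apply/fsubsetP => P /goodsP[PS gP].
  have PE : P \in E by apply/EP; split => //; apply: fsubset_trans PS (fsubsetUr _ _).
  by rewrite !inE PE/= sPF// !andbF.
have /choice[ga gaP] : forall Q, exists g, Q \in B ->
    g != 1%g /\ exists ct, repeating S s g ct Q.
  move=> Q; have [QB|QB] := boolP (Q \in B); last by exists 1%g.
  have /andP[/EP[QS gQ] /asboolPn nQ] : (Q \in E) && ~~ `[< good (s |` S) Q >].
    by move: QB; rewrite !inE.
  by have [g g1 rep] := bad_repeating sS QS gQ nQ; exists g.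
pose N : R := #|` goods S|%:R.
have BN : #|` B|%:R <= (2 - b) * N.
  pose E' := [fset ga Q | Q in B].
  pose Bg g := [fset Q in B | `[< exists ct, repeating S s g ct Q >]].
  have E'1 g : g \in E' -> g != 1%g by move=> /imfsetP[Q /= /gaP[? _] ->].
  have B1 : (#|` B| <= \sum_(g <- E') #|` Bg g|)%N.
    apply: (@card_cover_le _ _ E' (fun g Q => `[< exists ct, repeating S s g ct Q >])).
    move=> Q QB; have [_ rep] := gaP Q QB; exists (ga Q); last exact/asboolP.
    by apply/imfsetP; exists Q.
  apply: (@le_trans _ _ (\sum_(g <- E') (N * ((2 - b) * 2^-1 ^+ (f g).+1)))).
    apply: (@le_trans _ _ (\sum_(g <- E') #|` Bg g|%:R)).
      by rewrite -natr_sum ler_nat.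
    rewrite big_seq [leRHS]big_seq; apply: ler_sum => g gE'.
    have g1 := E'1 g gE'.
    apply: (@le_trans _ _ (N * (2 * #|` T g|%:R / b ^+ #|` T g|.-1))); last first.
      by rewrite ler_wpM2l ?ler0n// T_weight.
    pose r := [seq (c, t) | c <- [:: true; false], t <- T g].
    have B2 : (#|` Bg g| <=
        \sum_(ct <- r) #|` [fset Q in Bg g | `[< repeating S s g ct Q >]]|)%N.
      apply: (@card_cover_le _ _ r (fun ct Q => `[< repeating S s g ct Q >])) => Q.
      rewrite !inE/= => /andP[_ /asboolP[[c t] rep]]; exists (c, t); last exact/asboolP.
      by apply/allpairsP; exists (c, t); have [tT] := rep; split=> //; case: (c).
    rewrite -(ler_nat R) in B2; apply: (le_trans B2); rewrite natr_sum.
    apply: (@le_trans _ _ (\sum_(ct <- r) N / b ^+ #|` T g|.-1)).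
      apply: ler_sum => ct _; apply: (@card_repeating S s g ct) => //.
      by move=> Q; rewrite !inE/= => /andP[_ /asboolP].
    rewrite big_const_seq count_predT iter_addr_0 size_allpairs.
    by rewrite -[leLHS]mulr_natl natrM mulrCA.
  rewrite -mulr_sumr -mulr_sumr mulrA [leRHS]mulrC; apply: ler_piMr.
    by rewrite mulr_ge0// subr_ge0 ltW.
  rewrite -(big_map f predT (fun i => 2^-1 ^+ i.+1)).
  by apply: sum_dyadic_le1; rewrite map_inj_uniq ?fset_uniq.
have := E2; rewrite goodE -(ler_nat R) natrD natrM -/N; lra.
Qed.

Hypothesis T_neq0 : forall g, g != 1%g -> T g != fset0.

Lemma goods_ge S D : [disjoint D & S] ->
  b ^+ #|` D| * #|` goods S|%:R <= #|` goods (D `|` S)|%:R.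
Proof.
by apply: (@goods_chain _ _ #|` D `|` S|) => // S' s _; exact: goods_grow.
Qed.

Lemma goods_gt0 S : (0 < #|` goods S|)%N.
Proof.
have g0 : fset0 \in goods fset0.
  apply/goodsP; split=> // g k g1 kS.
  by have /fset0Pn[t /kS[]] := T_neq0 g1; rewrite inE.
have := goods_ge (fdisjointX0 S); rewrite fsetU0 -(ltr_nat R); apply: lt_le_trans.
rewrite mulr_gt0 ?exprn_gt0// ltr0n cardfs_gt0.
by apply/fset0Pn; exists fset0.
Qed.

Definition extendable S P := forall S', S `<=` S' ->
  exists2 Q, Q \in goods S' & Q `&` S = P.

Lemma extendable_goods S P : extendable S P -> P \in goods S.
Proof.
by move=> /(_ S (fsubset_refl _))[Q QS <-]; exact: goods_restrict.
Qed.

Lemma extendable_step S P s : extendable S P -> s \notin S ->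
  ~ extendable (s |` S) P -> extendable (s |` S) (s |` P).
Proof.
move=> eSP sS /existsNP[S1 /not_implyP[sS1 noQ]] S2 sS2.
have SS12 : S `<=` S1 `|` S2.
  exact: fsubset_trans (fsubsetUr _ _) (fsubset_trans sS1 (fsubsetUl _ _)).
have [Q gQ QP] := eSP _ SS12.
have QsS S' : s |` S `<=` S' ->
    Q `&` S' `&` (s |` S) = if s \in Q then s |` P else P.
  move=> /fsetIidPr sS'; rewrite -fsetIA sS' -QP.
  apply/fsetP => y; rewrite 2!fun_if !inE.
  have [->|] := eqVneq y s; first by rewrite (negbTE sS) !andbF; case: (s \in Q).
  by case: (s \in Q).
have [sQ|sQ] := boolP (s \in Q).
  exists (Q `&` S2); first by apply: goods_restrict gQ; exact: fsubsetUr.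
  by rewrite QsS// sQ.
exfalso; apply: noQ; exists (Q `&` S1).
  by apply: goods_restrict gQ; exact: fsubsetUl.
by rewrite QsS// (negbTE sQ).
Qed.

Lemma extendable_lang S P : extendable S P -> P \in lang distinguishing S.
Proof.
move=> eSP; pose e n : G := xget 1%g [set g | f g = n].
have eK g : e (f g) = g by apply: f_inj; apply: (@xgetPex _ 1%g [set h | f h = f g]); exists g.
pose next (s : G) (SP : {fset G} * {fset G}) :=
  if s \in SP.1 then SP else
  (s |` SP.1, if `[< extendable (s |` SP.1) SP.2 >] then SP.2 else s |` SP.2).
pose st := fix st n := if n is m.+1 then next (e m) (st m) else (S, P).
have ext n : extendable (st n).1 (st n).2.
  elim: n => //= n IH; rewrite /next; case: ifPn => //= sS.
  by have [/asboolP//|ne] := asboolP; exact: extendable_step.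
have sub n : (st n).2 `<=` (st n).1.
  by have /goodsP[] := extendable_goods (ext n).
have mono n m : (n <= m)%N -> (st n).1 `<=` (st m).1 /\ (st m).2 `&` (st n).1 = (st n).2.
  elim: m => [|m IH].
    by rewrite leqn0 => /eqP ->; split=> //; apply/fsetIidPl.
  rewrite leq_eqVlt => /orP[/eqP ->|/IH [S12 P12]].
    by split => //; apply/fsetIidPl.
  rewrite /= /next; case: ifPn => //= sS; split.
    exact: fsubset_trans S12 (fsubsetUr _ _).
  case: ifPn => // _; rewrite -P12; apply/fsetP => y; rewrite !inE.
  have [ys|//] := eqVneq y (e m); rewrite /= ys.
  by rewrite (contraNF (fsubsetP S12 _) sS) !andbF.
pose x : config G := fun g => `[< exists n, g \in (st n).2 >].
have xE n g : g \in (st n).1 -> x g = (g \in (st n).2).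
  move=> gS; apply/asboolP/idP => [[m gm]|gn]; last by exists n.
  have [/mono[nm mnE]|/ltnW/mono[nm mnE]] := leqP n m.
    by rewrite -mnE inE gm.
  by move: gm; rewrite -mnE inE => /andP[].
apply/langP; split; first exact: (sub 0).
exists x => [g k g1|s sS]; last exact: (xE 0).
pose W := translate k (T g) `|` translate (k * g)%g (T g).
have [n Wn] : exists n, W `<=` (st n).1.
  exists (\max_(y <- W) (f y).+1); apply/fsubsetP => y yW.
  have /mono[/fsubsetP + _] : ((f y).+1 <= \max_(y <- W) (f y).+1)%N.
    exact: (@leq_bigmax_seq _ _ xpredT (fun y => (f y).+1)).
  apply; rewrite /= eK /next; case: ifPn => //= _.
  by rewrite !inE eqxx.
have kW t : t \in T g -> (k * t)%g \in (st n).1 /\ (k * g * t)%g \in (st n).1.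
  by move=> tT; split; apply: (fsubsetP Wn); rewrite inE !mem_translate mulKg tT ?orbT.
have /goodsP[_ gn] := extendable_goods (ext n).
by have [t tT tP] := gn g k g1 kW; exists t; rewrite // !(xE n); have [] := kW t tT.
Qed.

Lemma goods_lang S : exists2 S', S `<=` S' &
  forall Q, Q \in goods S' -> Q `&` S \in lang distinguishing S.
Proof.
have /choice[W PW] : forall P, exists W, S `<=` W /\ (P \notin lang distinguishing S ->
    forall Q, Q \in goods W -> Q `&` S <> P).
  move=> P; have [PS|PS] := boolP (P \in lang distinguishing S); first by exists S.
  have /existsNP[W /not_implyP[SW noQ]] : ~ extendable S P.
    by move=> /extendable_lang; exact/negP.
  by exists W; split=> // _ Q gQ QP; apply: noQ; exists Q.
pose S' := S `|` \bigcup_(P <- fpowerset S) W P.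
exists S'; first exact: fsubsetUl.
move=> Q gQ; apply/negPn/negP => nQ; have [SW /(_ nQ)] := PW (Q `&` S).
move=> /(_ (Q `&` W (Q `&` S))); apply.
  apply: goods_restrict gQ; apply: fsubset_trans (fsubsetUr _ _).
  by apply: bigfcup_sup => //; rewrite fpowersetE fsubsetIr.
by rewrite -fsetIA (fsetIidPr SW).
Qed.

(* Counting the good patterns on a large S' through their traces on S and on
   the complement, since goods_ge says nothing of the traces on S alone. *)
Lemma lang_distinguishing_ge S : b ^+ #|` S| <= #|` lang distinguishing S|%:R.
Proof.
have [S' SS' gL] := goods_lang S.
pose U := S' `\` S.
have SU : U `|` S = S'.
  apply/fsetP => y; rewrite !inE; have := fsubsetP SS' y.
  by case: (y \in S) => [->|_] //; rewrite orbF.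
have le : #|` goods S'|%:R <= #|` lang distinguishing S|%:R * #|` goods U|%:R :> R.
  have PSU P : P \in goods S' -> P `<=` S `|` U.
    by case/goodsP; rewrite fsetUC SU.
  apply: (le_trans (card_traces2 R PSU)); rewrite -!natrM ler_nat leq_mul//.
    by apply/fsubset_leq_card/fsubsetP => _ /imfsetP[P/= /gL + ->].
  apply/fsubset_leq_card/fsubsetP => _ /imfsetP[P/= gP ->].
  by apply: goods_restrict gP; exact: fsubsetDl.
have ge : b ^+ #|` S| * #|` goods U|%:R <= #|` goods S'|%:R.
  by rewrite -SU fsetUC; apply: goods_ge; apply/fdisjointP => y; rewrite !inE => ->.
by have := le_trans ge le; rewrite ler_pM2r// ltr0n goods_gt0.
Qed.

End Construction.

Lemma exists_weight (R : realType) (b d : R) : 1 < b -> 0 < d ->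
  exists2 n, (0 < n)%N & 2 * n%:R / b ^+ n.-1 <= d.
Proof.
move=> b1 d0; pose h := b - 1; have h0 : 0 < h by rewrite subr_gt0.
have bern m : 1 + m%:R * h <= b ^+ m.
  elim: m => [|m IH]; first by rewrite mul0r addr0 expr0.
  have -> : b = 1 + h by rewrite /h; lra.
  rewrite exprS; apply: (@le_trans _ _ ((1 + h) * (1 + m%:R * h))).
    have : 0 <= m%:R * h * h by rewrite !mulr_ge0// ltW.
    by rewrite -natr1; lra.
  have -> : 1 + h = b by rewrite /h; lra.
  by rewrite ler_pM2l//; lra.
have [m mE] : exists m : nat, 6 / (h ^+ 2 * d) < m%:R.
  by exists (Num.truncn (6 / (h ^+ 2 * d))).+1; exact: truncnS_gt.
have dh0 : 0 < h ^+ 2 * d by rewrite mulr_gt0// exprn_gt0.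
have m0 : 0 < m%:R :> R by apply: lt_trans mE; rewrite divr_gt0.
have m1 : 1 <= m%:R :> R by move: m0; rewrite ltr0n ler1n.
exists (2 * m).+1 => //=; rewrite ler_pdivrMr ?exprn_gt0//; last by lra.
apply: (@le_trans _ _ (6 * m%:R)); first by rewrite -[(2 * m).+1%:R]natr1 natrM; lra.
move: mE; rewrite ltr_pdivrMr// => mE.
apply: (@le_trans _ _ (d * (m%:R * h) ^+ 2)).
  by rewrite exprMn; nra.
rewrite ler_pM2l// mulnC exprM ler_pXn2r// ?nnegrE ?mulr_ge0 ?exprn_ge0//; try lra.
by have := bern m; lra.
Qed.

Lemma exists_off_translate (G : groupType) (g : G) (n : nat) :
  infinite_set [set: G] -> g != 1%g ->
  exists2 T : {fset G}, #|` T|%fset = n & {in T, forall t, (g * t)%g \notin T}.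
Proof.
move=> Ginf g1; elim: n => [|n [T Tn gT]]; first by exists fset0%fset.
have [t] := exists_notin Ginf (T `|` translate g T `|` translate g^-1%g T)%fset.
rewrite !inE !mem_translate monoid.invgK !negb_or -andbA => /and3P[tT gVt gt].
exists (t |` T)%fset; first by rewrite cardfsU1 tT Tn.
move=> u; rewrite !inE negb_or => /orP[/eqP->|uT].
  rewrite gt andbT; apply: contraNneq g1 => gtt.
  by rewrite -[g](mulgK t) gtt mulgV.
by rewrite gT// andbT; apply: contraNneq gVt => <-; rewrite mulKg.
Qed.

Theorem corollary15 (R : realType) (G : groupType)
    (G_infinite : infinite_set [set: G])
    (G_countable : countable [set: G])
    (G_amenable : amenable R G)
    (eps : R) (eps_gt0 : 0 < eps) :
  exists X : set (config G),
    [/\ is_subshift X,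
        strongly_aperiodic X,
        cvgn (growth_seq R X) /\ 2 - eps <= growth R X
      & eps < 2 ->
        forall S : nat -> {fset G}, symmetric_folner R S ->
          cvgn (entropy_seq R X S) /\
          ((ln (2 - eps))%:E <= entropy R X S)%E].
Proof.
have [f f_inj] : exists f : G -> nat, injective f.
  have /countable_injP[f finj] := G_countable.
  by exists f => g h; apply: finj; rewrite inE.
pose b := Num.max (2 - eps) (3 / 2).
have b_ge : 2 - eps <= b by rewrite le_max lexx.
have b_gt1 : 1 < b by rewrite lt_max; apply/orP; right; lra.
have b_lt2 : b < 2 by rewrite gt_max; apply/andP; split; lra.
have /choice[T TP] : forall g : G, exists T : {fset G}, g != 1%g ->
    [/\ T != fset0%fset, {in T, forall t, (g * t)%g \notin T} &
        2 * #|` T|%fset%:R / b ^+ #|` T|%fset.-1 <= (2 - b) * 2^-1 ^+ (f g).+1].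
  move=> g; have [->|g1] := eqVneq g 1%g; first by exists fset0%fset.
  have [|n n0 nb] := @exists_weight R b ((2 - b) * 2^-1 ^+ (f g).+1) b_gt1.
    by rewrite mulr_gt0 ?exprn_gt0// subr_gt0.
  have [T Tn gT] := exists_off_translate n G_infinite g1.
  by exists T => _; rewrite Tn -cardfs_gt0 Tn.
have T0 g : g != 1%g -> T g != fset0%fset by move=> /TP[].
pose X := distinguishing T.
have X_ge S : b ^+ #|` S|%fset <= #|` lang X S|%fset%:R.
  by apply: (lang_distinguishing_ge b_gt1 b_lt2 f_inj) => // g /TP[].
have X_shift x g : X x -> X (fun y => x (g * y)%g) by exact: distinguishing_shift.
have X_neq0 : exists x, X x.
  have := X_ge fset0%fset; rewrite expr0 ler1n cardfs_gt0 => /fset0Pn[P].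
  by move=> /langP[_ [x Xx _]]; exists x.
have inf_ge : ln b <= rate_inf R X.
  apply: lb_le_inf.
    exists (rate R X [fset 1%g]%fset), [fset 1%g]%fset => //=.
    by apply/fset0Pn; exists 1%g; rewrite inE.
  move=> _ [S /= S0 <-]; have Sgt0 : 0 < #|` S|%fset%:R :> R by rewrite ltr0n cardfs_gt0.
  rewrite ler_pdivlMr// mulr_natr -lnXn; last by lra.
  by rewrite ler_ln ?posrE ?exprn_gt0 ?X_ge ?ltr0n ?card_lang_gt0//; lra.
exists X; split.
- exact: distinguishing_subshift.
- exact: distinguishing_aperiodic.
- have gr := @growth_cvg R G X X_shift X_neq0 G_infinite.
  split; first by apply/cvg_ex; exists (expR (rate_inf R X)).
  rewrite /growth (cvg_lim _ gr)//; apply: (le_trans b_ge).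
  by rewrite -[leLHS]lnK ?posrE ?ler_expR//; lra.
- move=> eps2 S Sfol.
  have ent_cvg : entropy_seq R X S @ \oo --> (rate_inf R X)%:E.
    rewrite [entropy_seq R X S](_ : _ = EFin \o (fun n => rate R X (S n))).
      apply: cvg_EFin; first by near=> n.
      exact: (@rate_cvg R G X X_shift X_neq0 S Sfol).
    apply/funext => n; rewrite /entropy_seq card_language//.
    by rewrite lne_EFin ?ltr0n ?card_lang_gt0// -EFinM.
  split; first by apply/cvg_ex; exists (rate_inf R X)%:E.
  rewrite /entropy (cvg_lim _ ent_cvg)// lee_fin; apply: le_trans inf_ge.
  by rewrite ler_ln ?posrE//; lra.
Unshelve. all: by end_near. Qed.
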